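(* Let $W_1<w_2<W_3$ be Markov irrationalities with $W_1,W_3$ neighbors and $w_2=W_3\odot W_1$. Let $k\ge0$ be an integer and set $w_1=w_2^{\odot k}\odot W_1$, $w_3=W_3\odot w_2^{\odot k}$ (with $w_2^{\odot0}\odot W_1=W_1$, $W_3\odot w_2^{\odot0}=W_3$). Then for all $t\in[\pi/3,2\pi/3]$, \[(2k+1)S(w_2,t)<S(w_1,t)+S(w_3,t)\quad\text{and}\quad(2k+1)S(w_2^{\mathrm{op}},t)<S(w_1^{\mathrm{op}},t)+S(w_3^{\mathrm{op}},t).\]
   Context: $F(x,t)=\frac{x}{1+x^2-2x\cos t}$. For a purely periodic $w=[\overline{a_1;\ldots,a_\ell}]$ written with its minimal even period length $\ell$ (indices cyclic), $w^{\mathrm{op}}=[\overline{a_\ell;\ldots,a_1}]$ and $S(w,t)=\sum_{i=1}^\ell\sum_{j=1}^{a_i}F([j;\overline{a_{i+1},\ldots,a_\ell,a_1,\ldots,a_i}],t)$. For such $u=[\overline{a_1;\ldots,a_r}]$, $v=[\overline{b_1;\ldots,b_s}]$, $u\odot v=[\overline{a_1;\ldots,a_r,b_1,\ldots,b_s}]$ and $u^{\odot k}$ is the $k$-fold conjunction. Fractions $a/b<c/d$ in $[0,1/2]$ are neighbors if $bc-ad=1$; every rational in $(0,1/2)$ is the mediant $(a+c)/(b+d)$ of a unique pair of neighbors. Define $w:[0,1/2]\cap\mathbb{Q}\to\mathbb{R}$ by $w(0/1)=[\overline{1;1}]$, $w(1/2)=[\overline{2;2}]$, $w\big(\frac{a+c}{b+d}\big)=w(c/d)\odot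 w(a/b)$ for neighbors $a/b<c/d$; its values are the Markov irrationalities, and two Markov irrationalities are neighbors if their parameters are neighbors. *)

(* Defs.v *)
From HB Require Import structures.
From mathcomp Require Import all_boot all_order all_algebra.
From mathcomp Require Import all_classical all_reals all_analysis.

Set Implicit Arguments.
Unset Strict Implicit.
Unset Printing Implicit Defensive.

Import Order.TTheory GRing.Theory Num.Theory.
Import numFieldNormedType.Exports.

Local Open Scope classical_set_scope.
Local Open Scope ring_scope.

(* Finite continued fraction [a_0; a_1, ..., a_n]; since 0^-1 = 0, the last
   step yields a_n + 0^-1 = a_n. *)
Definition finite_cf (R : realType) (s : seq nat) : R :=
  foldr (fun a x => a%:R + x^-1) 0 s.

Definition infinite_cf (R : realType) (a : nat -> nat) : R :=
  limn (fun n => finite_cf R (mkseq a n.+1)).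

(* The sequence pre, per, per, per, ... *)
Definition periodic_digits (pre per : seq nat) (n : nat) : nat :=
  if (n < size pre)%N then nth 0%N pre n
  else nth 0%N per ((n - size pre) %% size per).

Definition periodic_cf (R : realType) (pre per : seq nat) : R :=
  infinite_cf R (periodic_digits pre per).

Definition purely_periodic_cf (R : realType) (s : seq nat) : R :=
  periodic_cf R [::] s.

Definition even_period (R : realType) (x : R) (s : seq nat) : Prop :=
  [/\ (0 < size s)%N, ~~ odd (size s), all (leq 1) s
    & x = purely_periodic_cf R s].

Definition min_even_period (R : realType) (x : R) (s : seq nat) : Prop :=
  even_period x s /\
  forall s' : seq nat, even_period x s' -> (size s <= size s')%N.

(* The digits a_1, ..., a_l of x written with its minimal even period length l
   (unique by uniqueness of continued fraction expansions); the junk value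
   [::] is taken when x is not purely periodic. *)
Definition period (R : realType) (x : R) : seq nat :=
  xget [::] [set s | min_even_period x s].

Definition opposite (R : realType) (x : R) : R :=
  purely_periodic_cf R (rev (period x)).

Definition conjunction (R : realType) (u v : R) : R :=
  purely_periodic_cf R (period u ++ period v).

(* As a real number, u conjoined with itself is u again, so the k-fold
   conjunction of u only makes sense next to another factor:
   conj_pow_l k u v is u (.) (u (.) ... (u (.) v)), and
   conj_pow_r k v u is ((v (.) u) ... (.) u) (.) u, with k factors u. *)
Definition conj_pow_l (R : realType) (k : nat) (u v : R) : R :=
  iter k (fun x => conjunction u x) v.

Definition conj_pow_r (R : realType) (k : nat) (v u : R) : R :=
  iter k (fun x => conjunction x u) v.

Definition Fxt (R : realType) (x t : R) : R :=
  x / (1 + x ^+ 2 - 2 * x * cos t).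

(* The index i is shifted by one with respect to a_1, ..., a_l, so that
   rot i.+1 s is the rotation of s ending with the digit nth 0 s i. *)
Definition Sxt (R : realType) (x t : R) : R :=
  let s := period x in
  \sum_(i < size s) \sum_(1 <= j < (nth 0%N s i).+1)
     Fxt (periodic_cf R [:: j] (rot i.+1 s)) t.

Definition farey_neighbors (p q : rat) : Prop :=
  [/\ 0 <= p, p < q, q <= 1 / 2
    & denq p * numq q - numq p * denq q = 1].

Definition mediant (p q : rat) : rat :=
  (numq p + numq q)%:Q / (denq p + denq q)%:Q.

(* The graph of the map w: markov q x states x = w(q). *)
Inductive markov (R : realType) : rat -> R -> Prop :=
| markov_0 : markov 0 (purely_periodic_cf R [:: 1; 1]%N)
| markov_half : markov (1 / 2) (purely_periodic_cf R [:: 2; 2]%N)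
| markov_mediant (p q : rat) (x y : R) :
    farey_neighbors p q -> markov p x -> markov q y ->
    markov (mediant p q) (conjunction y x).

Definition markov_irrationality (R : realType) (x : R) : Prop :=
  exists q : rat, markov q x.

Definition markov_neighbors (R : realType) (x y : R) : Prop :=
  exists p q : rat, [/\ markov p x, markov q y
    & farey_neighbors p q \/ farey_neighbors q p].

(* Main.v *)
Require Import Defs.
From mathcomp Require Import all_boot all_order all_algebra.
From mathcomp Require Import all_classical all_reals all_analysis.
From mathcomp Require Import zify ring lra.

Import Order.TTheory GRing.Theory Num.Theory.
Import numFieldNormedType.Exports.
Local Open Scope ring_scope.

Set Implicit Arguments.
Unset Strict Implicit.
Unset Printing Implicit Defensive.

(** Write a Markov irrationality as a word in two letters, [false] for the
digits 1, 1 and [true] for 2, 2, and let [G w y] be the sum of F over the tails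
of [w] followed by [y]; then S(w^oo) = [G w (w^oo)] and G is a cocycle:
[G (u ++ v) y = G u (v y) + G v y].  In particular S is invariant under rotation
of the word.

By induction on the Farey tree, neighbors are [Z 0] and [1 Y] with
[1 Y Z 0 = Z 1 0 Y].  Put v = W3, u = W1 and rotate w1, w3 to
u' = u (v u)^k and v' = v (u v)^k, so that w2^(2k+1) = v' u' and the claim
reads S(v' u') < S(u') + S(v').  Let E < B < C < A be the values of u'^oo,
(u' v')^oo, (v' u')^oo, v'^oo.  Then B = u' C, C = v' B, and the difference of
the two sides is [(G v' A - G v' B) - (G u' C - G u' E)].  The word [1 Y] slides
through v' (that is, [1 Y v' = X 1 Y] for some X) and [0 Y] slides through u'.
As G is increasing, the first bracket is at least the increment of [G (1 Y)] over
[B, C].  Telescoping with a potential N such that [G w - N + N o w] is decreasing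
for every w, the second bracket is at most the increment of [G (0 Y) + N o (0 Y)]
over [B, C].  So everything reduces to the numerical fact that
[G 1 - G 0 - N o 0] is increasing, for which N(y) = - const / y is good enough.

Reversing a word exchanges the roles of Y and Z, which gives the second
inequality. *)

(** * The kernel on the relevant arcs *)

(** The triple angle formula turns cos(3a) = -1 into (cos a + 1)(2 cos a - 1)^2 = 0, and cos a > 0
    excludes the first factor. *)
Lemma cos_pi3 (R : realType) : cos (pi / 3 : R) = 1 / 2.
Proof.
have p0 := pi_gt0 R.
have h : 0 < cos (pi / 3 : R) by apply: cos_gt0_pihalf; apply/andP; split; lra.
set a := pi / 3 in h *.
have e3 : cos (a + a + a) = -1.
  by rewrite -cospi; congr (cos _); rewrite /a; field.
move: e3; rewrite !cosD sinD => e3.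
have := cos2Dsin2 a => e2.
have : (cos a + 1) * (2 * cos a - 1) ^+ 2 = 0.
  rewrite -!expr2 in e3 *.
  have -> : (cos a + 1) * (2 * cos a - 1) ^+ 2 =
    (cos a * cos a - sin a * sin a) * cos a - (sin a * cos a + cos a * sin a) * sin a + 1
    + (cos a ^+ 2 + sin a ^+ 2 - 1) * 3 * cos a by ring.
  by rewrite e3 e2; ring.
move/eqP; rewrite mulf_eq0 expf_eq0 /= => /orP[/eqP|/eqP]; lra.
Qed.

Lemma cos_middle_third (R : realType) (t : R) :
  pi / 3 <= t -> t <= 2 * pi / 3 -> - (1 / 2) <= cos t <= 1 / 2.
Proof.
move=> t1 t2; have p0 := pi_gt0 R; have c3 := cos_pi3 R.
have c23 : cos (2 * pi / 3 : R) = - (1 / 2).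
  rewrite -c3 (_ : 2 * pi / 3 = - (pi / 3) + pi); last by field.
  by rewrite cosDpi cosN.
have in0 (x : R) : 0 <= x <= pi -> x \in `[0, pi] by rewrite in_itv.
apply/andP; split.
  by rewrite -c23 leNgt ltr_cos ?in0 -?leNgt //; apply/andP; split; lra.
by rewrite -c3 leNgt ltr_cos ?in0 -?leNgt //; apply/andP; split; lra.
Qed.

Section Kernel.
Variables (R : realType) (t : R).
Hypothesis ht : - (1 / 2) <= cos t <= 1 / 2.
Local Notation c := (cos t).
Local Notation F x := (Fxt x t).

(** Up to binomial factors, for i, j, k at most 2 these are the Bernstein basis polynomials on the
    box of (x, y, cos t). *)
Lemma box_ge0 (l h x l' h' y : R) (i j k : nat) :
  l <= x <= h -> l' <= y <= h' ->
  0 <= ((x - l) ^+ i * (h - x) ^+ (2 - i)) *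
       ((y - l') ^+ j * (h' - y) ^+ (2 - j)) *
       ((c + 1 / 2) ^+ k * (1 / 2 - c) ^+ (2 - k)).
Proof.
move=> /andP[? ?] /andP[? ?]; case/andP: ht => ? ?.
by rewrite !mulr_ge0 ?exprn_ge0 ?subr_ge0 // -[1/2]opprK subr_ge0.
Qed.

(* Each polynomial below has nonnegative Bernstein coefficients of degree
   (2, 2, 2) on its box in (x, y, c), so it is a nonnegative combination of the
   27 products. *)
Ltac bernstein hx hy :=
  let H := fresh in
  have H i j k := box_ge0 i j k hx hy;
  move: (H 0 0 0)%N (H 0 0 1)%N (H 0 0 2)%N (H 0 1 0)%N (H 0 1 1)%N
    (H 0 1 2)%N (H 0 2 0)%N (H 0 2 1)%N (H 0 2 2)%N (H 1 0 0)%N (H 1 0 1)%N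
    (H 1 0 2)%N (H 1 1 0)%N (H 1 1 1)%N (H 1 1 2)%N (H 1 2 0)%N (H 1 2 1)%N
    (H 1 2 2)%N (H 2 0 0)%N (H 2 0 1)%N (H 2 0 2)%N (H 2 1 0)%N (H 2 1 1)%N
    (H 2 1 2)%N (H 2 2 0)%N (H 2 2 1)%N (H 2 2 2)%N;
  clear H; lra.

Local Notation q x := (1 + x ^+ 2 - 2 * x * c).

(* [-F'(3/2)], the unit in which the slopes of [F] are measured. *)
Definition slope_unit : R := 20 / (13 - 12 * c) ^+ 2.

Lemma slope_unit_gt0 : 0 < slope_unit.
Proof.
case/andP: ht => c1 c2.
by rewrite divr_gt0 // exprn_gt0 // subr_gt0; lra.
Qed.

(** F x - F y = (x y - 1)(y - x) / (q x q y). With denominators cleared, slope bounds become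
    polynomial inequalities of degree at most 2 in each of x, y and c. *)
Lemma Fxt_slope (lo hi x y : R) : 1 < x -> x <= y ->
  lo * (20 * (q x * q y)) <= (x * y - 1) * (13 - 12 * c) ^+ 2
    <= hi * (20 * (q x * q y)) ->
  lo * (slope_unit * (y - x)) <= F x - F y <= hi * (slope_unit * (y - x)).
Proof.
move=> x1 xy; case/andP: ht => c1 c2 /andP[h1 h2].
have qgt0 z : 1 < z -> 0 < q z by move=> z1; nra.
have qx := qgt0 x x1; have qy : 0 < q y by apply: qgt0; lra.
have d : 0 < 13 - 12 * c by lra.
have -> : F x - F y = (x * y - 1) / (q x * q y) * (y - x).
  by rewrite /Fxt; field; rewrite !gt_eqF.
have D0 : 0 < (13 - 12 * c) ^+ 2 by rewrite exprn_gt0.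
have unitE k : k * slope_unit * (q x * q y) =
    k * (20 * (q x * q y)) / (13 - 12 * c) ^+ 2.
  by rewrite /slope_unit; field; rewrite gt_eqF.
have lo_le : lo * slope_unit <= (x * y - 1) / (q x * q y).
  by rewrite ler_pdivlMr ?mulr_gt0 // unitE ler_pdivrMr.
have le_hi : (x * y - 1) / (q x * q y) <= hi * slope_unit.
  by rewrite ler_pdivrMr ?mulr_gt0 // unitE ler_pdivlMr.
by rewrite !(mulrA _ slope_unit) !ler_wpM2r ?subr_ge0.
Qed.

(** The interval [11/8, 7/4] contains every argument of F with integer part 1 met in [block_slopes];
    [19/8, 21/8] in [Fxt_slope_high] plays the same role for integer part 2. *)
Lemma Fxt_slope_low (x y : R) : 11 / 8 <= x -> x <= y -> y <= 7 / 4 ->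
  6 / 7 * (slope_unit * (y - x)) <= F x - F y
    <= 9 / 8 * (slope_unit * (y - x)).
Proof.
move=> x1 xy y1; apply: Fxt_slope => //; first by lra.
have hx : 11 / 8 <= x <= 7 / 4 by lra.
have hy : 11 / 8 <= y <= 7 / 4 by lra.
by apply/andP; split; bernstein hx hy.
Qed.

Lemma Fxt_slope_high (x y : R) : 19 / 8 <= x -> x <= y -> y <= 21 / 8 ->
  14 / 27 * (slope_unit * (y - x)) <= F x - F y
    <= 15 / 14 * (slope_unit * (y - x)).
Proof.
move=> x1 xy y1; apply: Fxt_slope => //; first by lra.
have hx : 19 / 8 <= x <= 21 / 8 by lra.
have hy : 19 / 8 <= y <= 21 / 8 by lra.
by apply/andP; split; bernstein hx hy.
Qed.

End Kernel.

Lemma inv_range (R : realType) (l h l' h' x : R) : 0 < l -> l <= x <= h ->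
  l' * h <= 1 -> 1 <= h' * l -> l' <= x^-1 <= h'.
Proof.
move=> l0 /andP[lx xh] hl' hh'.
have x0 : 0 < x := lt_le_trans l0 lx.
have h0 : 0 < h := lt_le_trans x0 xh.
rewrite -[x^-1]mul1r ler_pdivlMr // ler_pdivrMr //; apply/andP; split.
  have [l'0|l'0] := leP 0 l'; first by apply: le_trans hl'; rewrite ler_wpM2l.
  by apply: le_trans ler01; rewrite mulr_le0_ge0 // ltW.
apply: (le_trans hh'); rewrite ler_wpM2l //.
by rewrite -(pmulr_lge0 _ l0) (le_trans ler01).
Qed.

Lemma inv_slope (R : realType) (l h l' h' x y : R) :
  0 < l -> l <= x -> x <= y -> y <= h -> l' * h ^+ 2 <= 1 -> 1 <= h' * l ^+ 2 ->
  l' * (y - x) <= x^-1 - y^-1 <= h' * (y - x).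
Proof.
move=> l0 lx xy yh hl' hh'.
have x0 : 0 < x by lra.
have y0 : 0 < y by lra.
have -> : x^-1 - y^-1 = (x * y)^-1 * (y - x) by field; rewrite !gt_eqF.
have /andP[b1 b2] : l' <= (x * y)^-1 <= h'.
  apply: (@inv_range _ (l ^+ 2) (h ^+ 2)) => //; first by rewrite exprn_gt0.
  by rewrite !expr2 !ler_pM //; lra.
by rewrite !ler_wpM2r ?subr_ge0.
Qed.

(** * Increments of tail sums *)

Definition cf_act (R : realType) (s : seq nat) (y : R) : R :=
  foldr (fun a x => a%:R + x^-1) y s.

(** The tail [y] is arbitrary rather than periodic, so that increments in [y] can be studied; S is
    recovered at a fixed point of [s] ([Sxt_tail_sum]). *)
Fixpoint tail_sum (R : realType) (t : R) (s : seq nat) (y : R) : R :=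
  if s is a :: s' then
    \sum_(1 <= j < a.+1) Fxt (j%:R + (cf_act s' y)^-1) t + tail_sum t s' y
  else 0.

Lemma cf_act_cat (R : realType) (s1 s2 : seq nat) (y : R) :
  cf_act (s1 ++ s2) y = cf_act s1 (cf_act s2 y).
Proof. exact: foldr_cat. Qed.

Lemma tail_sum_cat (R : realType) (t : R) (s1 s2 : seq nat) (y : R) :
  tail_sum t (s1 ++ s2) y = tail_sum t s1 (cf_act s2 y) + tail_sum t s2 y.
Proof.
by elim: s1 => [|a s1 IH] /=; rewrite ?add0r // IH cf_act_cat addrA.
Qed.

(* Words over the two blocks: [false] stands for the digits 1, 1 and [true]
   for 2, 2. *)
Definition digits (w : seq bool) : seq nat :=
  flatten [seq [:: b.+1; b.+1] | b : bool <- w].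

Lemma digits_cat u v : digits (u ++ v) = digits u ++ digits v.
Proof. by rewrite /digits map_cat flatten_cat. Qed.

Local Notation act w := (cf_act (digits w)).

Section Blocks.
Variable R : realType.

(** Both blocks map this interval into itself, and it contains the value of every nonempty periodic
    block word ([cf_word_range]). *)
Definition in_range (y : R) := 8 / 5 <= y <= 5 / 2.

Lemma act_cat u v (y : R) : act (u ++ v) y = act u (act v y).
Proof. by rewrite digits_cat cf_act_cat. Qed.

Lemma act1E (y : R) : (act [:: false] y = 1 + (1 + y^-1)^-1) *
  (act [:: true] y = 2 + (2 + y^-1)^-1).
Proof. by []. Qed.

Lemma act1_range (y : R) : in_range y ->
  (8 / 5 <= act [:: false] y <= 7 / 4) * (19 / 8 <= act [:: true] y <= 5 / 2).
Proof.
move=> hy; have /andP[z1 z2] : 2 / 5 <= y^-1 <= 5 / 8.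
  by apply: (inv_range _ hy); lra.
have : 3 / 5 <= (1 + y^-1)^-1 <= 3 / 4.
  by apply: (@inv_range _ (7 / 5) (13 / 8)); lra.
have : 3 / 8 <= (2 + y^-1)^-1 <= 1 / 2.
  by apply: (@inv_range _ (12 / 5) (21 / 8)); lra.
by rewrite !act1E => /andP[? ?] /andP[? ?]; split; apply/andP; split; lra.
Qed.

Lemma act_range w (y : R) : in_range y -> in_range (act w y).
Proof.
elim: w => [//|b w IH] hy; rewrite -cat1s act_cat.
have := act1_range (IH hy) => -[/andP[? ?] /andP[? ?]].
by case: b; apply/andP; split; lra.
Qed.

Lemma inv_in_range (y : R) : in_range y -> 2 / 5 <= y^-1 <= 5 / 8.
Proof. by move=> hy; apply: (inv_range _ hy); lra. Qed.

Lemma inv_shift_slope (y y' : R) : in_range y -> in_range y' -> y <= y' ->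
  let d := y^-1 - y'^-1 in
  (0 <= d <= y' - y) *
  (3 / 8 * d <= (1 + y'^-1)^-1 - (1 + y^-1)^-1 <= 18 / 35 * d) *
  (1 / 7 * d <= (2 + y'^-1)^-1 - (2 + y^-1)^-1 <= 4 / 23 * d).
Proof.
move=> hy hy' yy' d; rewrite {}/d.
have : 0 * (y' - y) <= y^-1 - y'^-1 <= 1 * (y' - y).
  by case/andP: hy hy' => ? ? /andP[? ?]; apply: (@inv_slope _ (8 / 5) (5 / 2)); lra.
have := inv_in_range hy; have := inv_in_range hy'.
move: {hy hy'} (y^-1) (y'^-1) => z z' /andP[z1' z2'] /andP[z1 z2].
rewrite mul0r mul1r => /[dup] d0 /andP[z'z _]; rewrite subr_ge0 in z'z.
have zE a : z - z' = (a + z) - (a + z') by ring.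
by split; [split=> // |]; [rewrite (zE 1)|rewrite (zE 2)];
  [apply: (@inv_slope _ (7 / 5) (13 / 8))|apply: (@inv_slope _ (12 / 5) (21 / 8))]; lra.
Qed.

Lemma act1_slope b (y y' : R) : in_range y -> in_range y' -> y <= y' ->
  0 <= act [:: b] y' - act [:: b] y <= y' - y.
Proof.
move=> hy hy' yy'.
have := inv_shift_slope hy hy' yy' => -[[/andP[? ?] /andP[? ?]] /andP[? ?]].
by case: b; rewrite !act1E; apply/andP; split; lra.
Qed.

(** A block has two digits, each reversing the order, so it preserves the order. That no distance
    grows is what [cf_word_order] rests on. *)
Lemma act_slope w (y y' : R) : in_range y -> in_range y' -> y <= y' ->
  0 <= act w y' - act w y <= y' - y.
Proof.
move=> hy hy' yy'; elim: w => [|b w /andP[IH1 IH2]].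
  by rewrite lexx subr_ge0 yy'.
rewrite -cat1s !act_cat.
have /andP[? ?] : 0 <= act [:: b] (act w y') - act [:: b] (act w y)
    <= act w y' - act w y.
  by apply: act1_slope; rewrite -1?subr_ge0 //; apply: act_range.
by apply/andP; split; lra.
Qed.

Lemma act_le w (y y' : R) : in_range y -> in_range y' -> y <= y' ->
  act w y <= act w y'.
Proof. by move=> hy hy' /(act_slope w hy hy') /andP[]; rewrite subr_ge0. Qed.

Lemma act_lt w (y y' : R) : in_range y -> in_range y' -> y < y' ->
  act w y < act w y'.
Proof.
move=> hy hy' yy'; rewrite lt_neqAle act_le ?ltW // andbT.
apply/eqP; elim: w => [/= e|b w IH e]; first by rewrite e ltxx in yy'.
apply: IH; move: e; rewrite -cat1s !act_cat.
by case: b; rewrite !act1E; move/addrI/invr_inj/addrI/invr_inj.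
Qed.
End Blocks.

(** * Slopes of single blocks and the telescoping potential *)

Section Potential.
Variables (R : realType) (t : R).
Hypothesis ht : - (1 / 2) <= cos t <= 1 / 2.

(* The constant 21/10 is what makes both [block_tail_sum_le] and
   [block_tail_sum_lt] true. *)
Definition potential (y : R) : R := - (21 / 10 * slope_unit t) * y^-1.

Lemma tail_sum1E b (y : R) : tail_sum t (digits [:: b]) y =
  if b then Fxt (1 + (2 + y^-1)^-1) t + Fxt (2 + (2 + y^-1)^-1) t
         + Fxt (1 + y^-1) t + Fxt (2 + y^-1) t
  else Fxt (1 + (1 + y^-1)^-1) t + Fxt (1 + y^-1) t.
Proof.
have S2 (f : nat -> R) : \sum_(1 <= j < 3) f j = f 1%N + f 2%N.
  by rewrite (big_ltn (isT : (1 < 3)%N)) big_nat1.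
by case: b => /=; rewrite ?S2 ?big_nat1 addr0 ?addrA ?mulr1n.
Qed.

(** F decreases, so terms in 1/y increase with y, while terms in 1/(1 + 1/y) or 1/(2 + 1/y)
    decrease. The last clause is proved separately because F(1 + 1/y) occurs in both blocks and
    cancels; subtracting the individual bounds would lose too much. *)
Lemma block_slopes (y y' : R) : in_range y -> in_range y' -> y <= y' ->
  let d := slope_unit t * (y^-1 - y'^-1) in
  let dG b := tail_sum t (digits [:: b]) y' - tail_sum t (digits [:: b]) y in
  let dN b := potential (act [:: b] y') - potential (act [:: b] y) in
  (1 / 4 * d <= dG false <= 6 / 5 * d) *
  (0 <= dG true <= 2 * d) *
  (0 <= dN false <= 4 / 9 * d) *
  (0 <= dN true <= 1 / 15 * d) *
  (dG false + 9 / 20 * d <= dG true).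
Proof.
move=> hy hy' yy' d dG dN; rewrite {}/d {}/dG {}/dN.
have := inv_in_range hy; have := inv_in_range hy'.
have := inv_shift_slope hy hy' yy'.
have := act1_range hy; have := act1_range hy'.
have := ltW (slope_unit_gt0 ht).
have low := Fxt_slope_low ht; have high := Fxt_slope_high ht.
rewrite !tail_sum1E /potential !act1E.
move: (slope_unit t) low high {hy hy' yy'} => r low high r0.
(* With z = 1/y, p = 1/(1 + z), q = 1/(2 + z), and below m = 1/(1 + p), n = 1/(2 + q), all made
   variables, only linear slope inequalities remain once multiplied by [r]. *)
move: (1 + y^-1)^-1 (1 + y'^-1)^-1 (2 + y^-1)^-1 (2 + y'^-1)^-1 => p p' q q'.
move: (y^-1) (y'^-1) => z z'.
move=> [/andP[p1' p2'] /andP[q1' q2']] [/andP[p1 p2] /andP[q1 q2]].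
move=> [[/andP[d0 _] /andP[dp1 dp2]] /andP[dq1 dq2]] /andP[z1' z2'] /andP[z1 z2].
have pp' : p <= p' by clear - d0 dp1; lra.
have qq' : q <= q' by clear - d0 dq1; lra.
have zz' : z' <= z by rewrite -subr_ge0.
have : 0 * ((1 + p') - (1 + p)) <= (1 + p)^-1 - (1 + p')^-1 <=
    2 / 5 * ((1 + p') - (1 + p)).
  by apply: (@inv_slope _ (8 / 5) (7 / 4)); rewrite ?lerD2l //; lra.
have : 0 * ((2 + q') - (2 + q)) <= (2 + q)^-1 - (2 + q')^-1 <=
    2 / 11 * ((2 + q') - (2 + q)).
  by apply: (@inv_slope _ (19 / 8) (5 / 2)); rewrite ?lerD2l //; lra.
move: (1 + p)^-1 (1 + p')^-1 (2 + q)^-1 (2 + q')^-1 => m m' n n'.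
rewrite !mul0r => /andP[n1 n2] /andP[m1 m2].
have := low (1 + z') (1 + z); have := high (2 + z') (2 + z).
have := low (1 + p) (1 + p'); have := low (1 + q) (1 + q').
have := high (2 + q) (2 + q').
move: (Fxt (1 + z) t) (Fxt (1 + z') t) (Fxt (2 + z) t) (Fxt (2 + z') t).
move: (Fxt (1 + p) t) (Fxt (1 + p') t) (Fxt (1 + q) t) (Fxt (1 + q') t).
move: (Fxt (2 + q) t) (Fxt (2 + q') t) => A A' B B' C C' D D' E E'.
rewrite !lerD2l.
case/(_ ltac:(clear - q1; lra) qq' ltac:(clear - q2'; lra))/andP => A1 A2.
case/(_ ltac:(clear - q1; lra) qq' ltac:(clear - q2'; lra))/andP => C1 C2.
case/(_ ltac:(clear - p1; lra) pp' p2')/andP => B1 B2.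
case/(_ ltac:(clear - z1'; lra) zz' ltac:(clear - z2; lra))/andP => E1 E2.
case/(_ ltac:(clear - z1'; lra) zz' ltac:(clear - z2; lra))/andP => D1 D2.
have mr (u v : R) : u <= v -> r * u <= r * v by apply: ler_wpM2l.
have := mr _ _ d0; have := mr _ _ dp1; have := mr _ _ dp2.
have := mr _ _ dq1; have := mr _ _ dq2.
have := mr _ _ n1; have := mr _ _ n2; have := mr _ _ m1; have := mr _ _ m2.
clear - A1 A2 B1 B2 C1 C2 D1 D2 E1 E2 => *.
by split; [split; [split; [split|]|]|]; try apply/andP; try split; lra.
Qed.

(** The upper bound amounts to 6/5 + 4/9 <= 21/10 for the block 1, 1 and to 2 + 1/15 <= 21/10 for
    the block 2, 2. *)
Lemma block_tail_sum_le b (y y' : R) : in_range y -> in_range y' -> y <= y' ->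
  0 <= tail_sum t (digits [:: b]) y' - tail_sum t (digits [:: b]) y <=
  (potential y' - potential y) - (potential (act [:: b] y') - potential (act [:: b] y)).
Proof.
move=> hy hy' yy'; have /= := block_slopes hy hy' yy'.
move=> -[[[[/andP[? ?] /andP[? ?]] /andP[? ?]] /andP[? ?]] ?].
have -> : potential y' - potential y = 21 / 10 * (slope_unit t * (y^-1 - y'^-1)).
  by rewrite /potential; ring.
have := inv_shift_slope hy hy' yy' => -[[/andP[d1 _] _] _].
have := mulr_ge0 (ltW (slope_unit_gt0 ht)) d1 => ?.
by case: b; apply/andP; split; lra.
Qed.

(** The margin is 9/20 - 4/9 > 0, by the last clause of [block_slopes]. *)
Lemma block_tail_sum_lt (y y' : R) : in_range y -> in_range y' -> y < y' ->
  tail_sum t (digits [:: false]) y' - tail_sum t (digits [:: false]) y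
    + (potential (act [:: false] y') - potential (act [:: false] y))
  < tail_sum t (digits [:: true]) y' - tail_sum t (digits [:: true]) y.
Proof.
move=> hy hy' yy'; have /= := block_slopes hy hy' (ltW yy').
move=> -[[[[/andP[? ?] /andP[? ?]] /andP[? ?]] /andP[? ?]] ?].
have : 0 < slope_unit t * (y^-1 - y'^-1).
  rewrite mulr_gt0 ?slope_unit_gt0 // subr_gt0.
  by case/andP: hy hy' => ? _ /andP[? _]; rewrite ltf_pV2 // posrE; lra.
by move=> ?; lra.
Qed.

(** The potential differences telescope along the word, so the bound does not deteriorate with its
    length. *)
Lemma tail_sum_slope w (y y' : R) : in_range y -> in_range y' -> y <= y' ->
  0 <= tail_sum t (digits w) y' - tail_sum t (digits w) y <=
  (potential y' - potential y) - (potential (act w y') - potential (act w y)).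
Proof.
move=> hy hy' yy'; elim: w => [|b w /andP[IH1 IH2]].
  by rewrite /= !subrr lexx.
rewrite -cat1s digits_cat !tail_sum_cat !cf_act_cat.
have /andP[] := block_tail_sum_le b (act_range w hy) (act_range w hy')
  (act_le w hy hy' yy').
by move=> ? ?; apply/andP; split; lra.
Qed.

Lemma tail_sum_le w (y y' : R) : in_range y -> in_range y' -> y <= y' ->
  tail_sum t (digits w) y <= tail_sum t (digits w) y'.
Proof. by move=> hy hy' /(tail_sum_slope w hy hy') /andP[]; rewrite subr_ge0. Qed.
End Potential.

(** * Continued fractions *)

Section ContinuedFractions.
Variable R : realType.
Implicit Types (s : seq nat) (x y : R) (a : nat -> nat).

Lemma cf_act_ge1 s y : all (leq 1) s -> 1 <= y -> 1 <= cf_act s y.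
Proof.
move=> + y1; elim: s => [//|d s IH] /= /andP[d1 /IH s1].
by rewrite (le_trans (_ : 1 <= d%:R)) ?ler1n // lerDl invr_ge0 (le_trans ler01).
Qed.

Lemma cf_act_step d x y : 1 <= x -> 1 <= y ->
  `|cf_act [:: d] x - cf_act [:: d] y| = `|x - y| / (x * y).
Proof.
move=> x1 y1; have x0 : 0 < x by lra.
have y0 : 0 < y by lra.
have -> : cf_act [:: d] x - cf_act [:: d] y = - ((x - y) / (x * y)).
  by rewrite /=; field; rewrite !gt_eqF.
by rewrite normrN normrM normfV (gtr0_norm (mulr_gt0 x0 y0)).
Qed.

(** One digit does not increase distances, and two digits divide them by (e u + 1)(e v + 1) >= 4.
    The factor 2 absorbs an unpaired digit. *)
Lemma cf_act_contract s x y : all (leq 1) s -> 1 <= x -> 1 <= y ->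
  `|cf_act s x - cf_act s y| <= 2 * (1 / 2) ^+ size s * `|x - y|.
Proof.
move=> + x1 y1; elim: {s}(size s) {-2}s (leqnn (size s)) => [|n IH] s.
  by case: s => // _ _; rewrite expr0 mulr1 ler_peMl // ler1n.
case: s => [|d [|e s]] //= sn.
- by move=> _; rewrite expr0 mulr1 ler_peMl // ler1n.
- move=> _; have := cf_act_step d x1 y1 => /= ->.
  rewrite expr1 mulrC ler_wpM2r // (_ : 2 * (1 / 2) = 1); last by field.
  by rewrite invf_le1 ?mulr_ege1 // mulr_gt0 //; lra.
- move=> /and3P[d1 e1 s1].
  have u1 := cf_act_ge1 s1 x1; have v1 := cf_act_ge1 s1 y1.
  have := IH s ltac:(lia) s1.
  move: (cf_act s x) (cf_act s y) u1 v1 => u v u1 v1 h.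
  have u0 : 0 < u by lra.
  have v0 : 0 < v by lra.
  have e0 : 1 <= e%:R :> R by rewrite ler1n.
  have eu : 0 < e%:R + u^-1 by rewrite addr_gt0 ?invr_gt0 //; lra.
  have ev : 0 < e%:R + v^-1 by rewrite addr_gt0 ?invr_gt0 //; lra.
  have pu : 2 <= e%:R * u + 1 by have := mulr_ege1 e0 u1; lra.
  have pv : 2 <= e%:R * v + 1 by have := mulr_ege1 e0 v1; lra.
  have -> : d%:R + (e%:R + u^-1)^-1 - (d%:R + (e%:R + v^-1)^-1) =
      ((e%:R * u + 1) * (e%:R * v + 1))^-1 * (u - v).
    by field; rewrite !gt_eqF //; lra.
  rewrite normrM normfV.
  have q4 : 2 * 2 <= (e%:R * u + 1) * (e%:R * v + 1) by rewrite ler_pM.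
  have q0 : 0 < (e%:R * u + 1) * (e%:R * v + 1) by apply: lt_le_trans q4; lra.
  rewrite (gtr0_norm q0).
  rewrite !exprS.
  have -> : 2 * (1 / 2 * (1 / 2 * (1 / 2) ^+ size s)) * `|x - y| =
      (2 * 2)^-1 * (2 * (1 / 2) ^+ size s * `|x - y|) :> R by field.
  by rewrite ler_pM ?invr_ge0 ?lef_pV2 ?posrE //; lra.
Qed.

Lemma finite_cf_rcons s d : finite_cf R (rcons s d) = cf_act s d%:R.
Proof. by rewrite -cats1 /finite_cf foldr_cat /= invr0 addr0. Qed.

Lemma mkseq_pos a n : (forall i, (0 < a i)%N) -> all (leq 1) (mkseq a n).
Proof. by move=> a0; apply/allP => _ /mapP[i _ ->]. Qed.

(** Consecutive convergents are the images of a_n and a_n + 1/a_(n+1) under the same n digits, so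
    their differences are dominated by a geometric series. *)
Lemma infinite_cf_cvg a : (forall i, (0 < a i)%N) ->
  (finite_cf R (mkseq a n.+1) @[n --> \oo] --> infinite_cf R a)%classic.
Proof.
move=> a0; set u := fun n => finite_cf R (mkseq a n.+1).
suff : cvgn u by [].
have uE n : u n = cf_act (mkseq a n) (a n)%:R.
  by rewrite /u mkseqS finite_cf_rcons.
have uS n : u n.+1 = cf_act (mkseq a n) ((a n)%:R + (a n.+1)%:R^-1).
  by rewrite uE mkseqS -cats1 cf_act_cat.
have -> : u = (fun n => u 0%N + series (telescope u) n).
  by apply/funext => n; rewrite -eq_sum_telescope.
apply: is_cvgD; first exact: is_cvg_cst.
apply: normed_cvg.
have : cvgn (series (geometric (2 : R) (1 / 2))).
  by apply: is_cvg_geometric_series; rewrite ger0_norm; lra.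
apply: series_le_cvg => n /=; first exact: normr_ge0.
  by rewrite mulr_ge0 // exprn_ge0 //; lra.
have d1 : 1 <= (a n)%:R :> R by rewrite ler1n.
have i0 : 0 <= (a n.+1)%:R^-1 :> R by rewrite invr_ge0 ler0n.
have i1 : (a n.+1)%:R^-1 <= 1 :> R by rewrite invf_le1 ?ltr0n // ler1n a0.
rewrite /telescope /= uS uE.
apply: (le_trans (cf_act_contract (mkseq_pos n a0) _ d1)); first by lra.
rewrite size_mkseq addrC addKr ger0_norm //.
by rewrite ler_piMr // mulr_ge0 // exprn_ge0 //; lra.
Qed.

Lemma finite_cf_ge1 a n : (forall i, (0 < a i)%N) ->
  1 <= finite_cf R (mkseq a n.+1).
Proof.
move=> a0; rewrite mkseqS finite_cf_rcons.
by apply: cf_act_ge1; rewrite ?mkseq_pos // ler1n.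
Qed.

Lemma infinite_cf_ge1 a : (forall i, (0 < a i)%N) -> 1 <= infinite_cf R a.
Proof.
move=> a0; apply: limr_ge.
  by apply/cvg_ex; exists (infinite_cf R a); exact: infinite_cf_cvg.
by apply: nearW => n; apply: finite_cf_ge1.
Qed.

Lemma mkseq_head a n : mkseq a n.+1 = a 0%N :: mkseq (fun i => a i.+1) n.
Proof. by rewrite /mkseq /= (iotaDl 1 0) -map_comp. Qed.

Lemma infinite_cf_rec a : (forall i, (0 < a i)%N) ->
  infinite_cf R a = (a 0%N)%:R + (infinite_cf R (fun i => a i.+1))^-1.
Proof.
move=> a0; set b := fun i => a i.+1.
have b0 i : (0 < b i)%N by apply: a0.
apply: cvg_lim => //.
have E : (fun n => finite_cf R (mkseq a n.+2)) =
    (fun n => (a 0%N)%:R + (finite_cf R (mkseq b n.+1))^-1).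
  by apply/funext => n; rewrite mkseq_head.
rewrite -cvg_shiftS; rewrite -/(fun n => finite_cf R (mkseq a n.+2)) E.
apply: cvgD; first exact: cvg_cst.
apply: cvgV; last exact: infinite_cf_cvg.
by rewrite gt_eqF // (lt_le_trans ltr01) // infinite_cf_ge1.
Qed.

Lemma infinite_cf_itv a : (forall i, (0 < a i)%N) ->
  (a 0%N)%:R < infinite_cf R a < (a 0%N).+1%:R.
Proof.
have gt_head b : (forall i, (0 < b i)%N) -> (b 0%N)%:R < infinite_cf R b.
  move=> b0; rewrite infinite_cf_rec // ltrDl invr_gt0 (lt_le_trans ltr01) //.
  exact: infinite_cf_ge1.
move=> a0; rewrite gt_head //= infinite_cf_rec // -natr1 ltrD2l invf_lt1.
  by apply: le_lt_trans (gt_head (fun i => a i.+1) _); rewrite ?ler1n.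
by rewrite (lt_le_trans ltr01) // infinite_cf_ge1.
Qed.

(** The first digit is the integer part by [infinite_cf_itv]; removing it leaves equal tails. This
    is what pins down [period], a choice among digit words with a given value. *)
Lemma infinite_cf_inj a b : (forall i, (0 < a i)%N) -> (forall i, (0 < b i)%N) ->
  infinite_cf R a = infinite_cf R b -> a =1 b.
Proof.
move=> + + + n; elim: n a b => [|n IH] a b a0 b0 e.
  have /andP[a1 a2] := infinite_cf_itv a0; have /andP[b1 b2] := infinite_cf_itv b0.
  rewrite e in a1 a2; have := lt_trans a1 b2; have := lt_trans b1 a2.
  by rewrite !ltr_nat !ltnS => ? ?; apply/eqP; rewrite eqn_leq; apply/andP.
have h : a 0%N = b 0%N.
  have /andP[a1 a2] := infinite_cf_itv a0; have /andP[b1 b2] := infinite_cf_itv b0.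
  rewrite e in a1 a2; have := lt_trans a1 b2; have := lt_trans b1 a2.
  by rewrite !ltr_nat !ltnS => ? ?; apply/eqP; rewrite eqn_leq; apply/andP.
apply: (IH (fun i => a i.+1) (fun i => b i.+1)) => //.
by move: e; rewrite infinite_cf_rec // [RHS]infinite_cf_rec // h => /addrI/invr_inj.
Qed.

Lemma infinite_cf_act a n : (forall i, (0 < a i)%N) ->
  infinite_cf R a = cf_act (mkseq a n) (infinite_cf R (fun i => a (n + i)%N)).
Proof.
elim: n a => [|n IH] a a0 //.
by rewrite mkseq_head /= infinite_cf_rec // (IH (fun i => a i.+1)).
Qed.

Lemma eq_infinite_cf a b : a =1 b -> infinite_cf R a = infinite_cf R b.
Proof. by move=> /funext ->. Qed.

Lemma periodic_digits_pos pre per : all (leq 1) pre -> all (leq 1) per ->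
  (0 < size per)%N -> forall i, (0 < periodic_digits pre per i)%N.
Proof.
move=> pre1 per1 per0 i; rewrite /periodic_digits; case: ifP => hi.
  exact: (all_nthP _ pre1).
by apply: (all_nthP _ per1); rewrite ltn_mod.
Qed.

Lemma purely_periodic_cf_ge1 s : all (leq 1) s -> (0 < size s)%N ->
  1 <= purely_periodic_cf R s.
Proof. by move=> s1 s0; apply: infinite_cf_ge1; apply: periodic_digits_pos. Qed.

Lemma purely_periodic_cf_fix s : all (leq 1) s -> (0 < size s)%N ->
  cf_act s (purely_periodic_cf R s) = purely_periodic_cf R s.
Proof.
move=> s1 s0; rewrite {2}/purely_periodic_cf /periodic_cf.
rewrite (infinite_cf_act (size s)); last exact: periodic_digits_pos.
congr cf_act.
  apply: (@eq_from_nth _ 0%N); first by rewrite size_mkseq.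
  by move=> i hi; rewrite nth_mkseq // /periodic_digits /= subn0 modn_small.
by apply: eq_infinite_cf => i; rewrite /periodic_digits /= !subn0 modnDl.
Qed.

(** Both numbers are fixed by [s ++ s], which has at least four digits and so contracts distances by
    a factor at most 1/8. *)
Lemma purely_periodic_cf_unique s x : all (leq 1) s -> (1 < size s)%N -> 1 <= x ->
  cf_act s x = x -> x = purely_periodic_cf R s.
Proof.
move=> s1 s2 x1 fx.
have s0 : (0 < size (s ++ s))%N by rewrite size_cat; lia.
set y := purely_periodic_cf R s.
have fy : cf_act s y = y by apply: purely_periodic_cf_fix => //; lia.
have y1 : 1 <= y by apply: purely_periodic_cf_ge1 => //; lia.
have := @cf_act_contract (s ++ s) x y.
rewrite all_cat s1 !cf_act_cat !fx !fy => /(_ isT x1 y1).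
have : (1 / 2) ^+ size (s ++ s) <= (1 / 2) ^+ 4 :> R.
  by apply: ler_wiXn2l; rewrite ?size_cat; [lra|lra|lia].
move: ((1 / 2) ^+ size (s ++ s)) => p hp h.
apply/eqP; rewrite -subr_eq0 -normr_le0.
have n0 := normr_ge0 (x - y).
have : 2 * p * `|x - y| <= 1 / 2 * `|x - y| by rewrite ler_wpM2r //; lra.
lra.
Qed.

Lemma periodic_cf1 d s : (0 < d)%N -> all (leq 1) s -> (0 < size s)%N ->
  periodic_cf R [:: d] s = d%:R + (purely_periodic_cf R s)^-1.
Proof.
move=> d0 s1 s0; rewrite /periodic_cf infinite_cf_rec; last first.
  by apply: periodic_digits_pos; rewrite //= d0.
by congr (_ + _^-1).
Qed.

(** Turns the rotated periods in [Sxt] into tails within a single pass through the period. *)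
Lemma purely_periodic_cf_rot i s : all (leq 1) s -> (1 < size s)%N ->
  purely_periodic_cf R (rot i s) = cf_act (drop i s) (purely_periodic_cf R s).
Proof.
move=> s1 s2; have : all (leq 1) (drop i s ++ take i s).
  by rewrite all_cat andbC -all_cat cat_take_drop.
rewrite all_cat => /andP[d1 t1].
symmetry; apply: purely_periodic_cf_unique.
- by rewrite all_cat d1 t1.
- by rewrite size_rot.
- by rewrite cf_act_ge1 // purely_periodic_cf_ge1 //; lia.
- rewrite cf_act_cat -(cf_act_cat (take i s)) cat_take_drop.
  by rewrite purely_periodic_cf_fix //; lia.
Qed.

Lemma tail_sumE t s y : tail_sum t s y = \sum_(i < size s)
  \sum_(1 <= j < (nth 0%N s i).+1) Fxt (j%:R + (cf_act (drop i.+1 s) y)^-1) t.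
Proof.
elim: s => [|d s IH] /=; first by rewrite big_ord0.
by rewrite big_ord_recl /= drop0 IH.
Qed.

Lemma Sxt_tail_sum t s x : all (leq 1) s -> (1 < size s)%N -> period x = s ->
  x = purely_periodic_cf R s -> Sxt x t = tail_sum t s x.
Proof.
move=> s1 s2 px ex; rewrite /Sxt px tail_sumE; apply: eq_bigr => i _.
apply: eq_big_nat => j /andP[j1 _].
rewrite periodic_cf1 //; last by rewrite size_rot; lia.
  by rewrite purely_periodic_cf_rot -?ex.
by rewrite /rot all_cat andbC -all_cat cat_take_drop.
Qed.
End ContinuedFractions.

(** * Periods of block words *)

Lemma size_digits w : size (digits w) = (size w).*2.
Proof. by rewrite /digits; elim: w => //= b w ->; rewrite doubleS. Qed.

Lemma all_digits w : all (leq 1) (digits w).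
Proof. by rewrite /digits; elim: w. Qed.

Lemma rev_digits w : rev (digits w) = digits (rev w).
Proof.
elim: w => // b w IH; rewrite -cat1s digits_cat rev_cat IH rev_cat digits_cat.
by [].
Qed.

Lemma nth_digits w i : (i < size w)%N ->
  nth 0%N (digits w) i.*2 = (nth false w i).+1.
Proof. by elim: w i => // b w IH [|i] //=; rewrite ltnS => /IH. Qed.

(** By Bezout, u m = v n + gcd(m, n) for some u and v: a shift by the gcd followed by v shifts by n
    is u shifts by m. *)
Lemma period_gcdn (T : Type) (a : nat -> T) m n : (0 < m)%N ->
  (forall i, a (i + m)%N = a i) -> (forall i, a (i + n)%N = a i) ->
  forall i, a (i + gcdn m n)%N = a i.
Proof.
move=> m0 am an i.
have mul p k j : (forall i, a (i + p)%N = a i) -> a (j + k * p)%N = a j.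
  by move=> ap; elim: k => [|k IH]; rewrite ?addn0 // mulSn addnCA addnC ap.
have [u v e _] := egcdnP n m0.
by rewrite -(mul n v _ an) -addnA [(gcdn _ _ + _)%N]addnC -e mul.
Qed.

Lemma sum_period (a : nat -> nat) g k : (forall i, a (i + g)%N = a i) ->
  (\sum_(0 <= i < k * g) a i = k * \sum_(0 <= i < g) a i)%N.
Proof.
move=> ag; elim: k => [|k IH]; first by rewrite big_geq.
rewrite mulSn mulSn (big_cat_nat _ (leq_addr (k * g) g)) //=; congr addn.
rewrite -IH -{1}[g]add0n big_addn addKn.
by apply: eq_bigr => i _.
Qed.

Lemma count_nth w : count_mem true w =
  (\sum_(0 <= i < size w) nth false w (i %% size w))%N.
Proof.
rewrite -sum1_count (big_nth false) big_mkcond.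
apply: eq_big_nat => i /andP[_ hi].
by rewrite modn_small //; case: nth.
Qed.

(** * Values and sums attached to block words *)

Section Words.
Variable R : realType.

Definition cf_word (w : seq bool) : R := purely_periodic_cf R (digits w).

(** This arithmetic condition excludes proper powers: the exponent would divide both numbers. For
    Markov words it expresses that a fraction is in lowest terms. *)
Definition primitive (w : seq bool) := coprime (count_mem true w) (size w).

Lemma primitive_size w : primitive w -> (0 < size w)%N.
Proof. by case: w. Qed.

Lemma even_period_digits w : (0 < size w)%N ->
  even_period (cf_word w) (digits w).
Proof.
by move=> w0; split; rewrite ?size_digits ?odd_double ?double_gt0 ?all_digits.
Qed.

Lemma even_period_digitsE w s : (0 < size w)%N -> even_period (cf_word w) s ->
  periodic_digits [::] (digits w) =1 periodic_digits [::] s.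
Proof.
move=> w0 [s0 _ s1]; rewrite /cf_word => e.
apply: (@infinite_cf_inj R) => //; apply: periodic_digits_pos => //.
  exact: all_digits.
by rewrite size_digits double_gt0.
Qed.

(** Reading every second digit, [size w] and half of [size s] are periods of the block sequence,
    hence so is their gcd g. Then size w / g divides both the length and the number of letters
    [true], so it is 1, and [size w] divides half of [size s]. *)
Lemma even_period_size w s : primitive w -> even_period (cf_word w) s ->
  (size (digits w) <= size s)%N.
Proof.
move=> pw ps; have w0 := primitive_size pw.
have e := even_period_digitsE w0 ps; case: ps => s0 so s1 _.
set b := fun i => nth false w (i %% size w).
have bE i : (b i).+1 = periodic_digits [::] s i.*2.
  rewrite -e /periodic_digits /= subn0 size_digits -!muln2 -muln_modl muln2.
  by rewrite nth_digits // ltn_mod.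
have bw i : b (i + size w)%N = b i by rewrite /b modnDr.
have bs i : b (i + (size s)./2)%N = b i.
  have : (b (i + (size s)./2)%N).+1 = (b i).+1.
    rewrite !bE doubleD (even_halfK so) /periodic_digits /= !subn0.
    by rewrite modnDr.
  by case: (b _); case: (b _).
have bg := period_gcdn w0 bw bs.
set g := gcdn _ _ in bg.
have [k kE] : exists k, size w = (k * g)%N.
  by apply/dvdnP; exact: dvdn_gcdl.
have : (k %| gcdn (count_mem true w) (size w))%N.
  rewrite dvdn_gcd [X in _ && (_ %| X)%N]kE dvdn_mulr // andbT count_nth.
  rewrite [X in index_iota 0 X]kE.
  by rewrite (sum_period (a := fun i => b i : nat)) ?dvdn_mulr // => i; rewrite bg.
rewrite (eqP pw) dvdn1 => /eqP k1; rewrite k1 mul1n in kE.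
have : (size w <= (size s)./2)%N.
  rewrite {1}kE; apply: dvdn_leq; last exact: dvdn_gcdr.
  by rewrite half_gt0; case: (size s) s0 so => [|[]].
by rewrite size_digits -leq_double (even_halfK so).
Qed.

(** Words of equal length that repeat to the same digit sequence coincide, so the minimal even
    period is unique and [xget] has no choice. *)
Lemma period_cf_word w : primitive w -> period (cf_word w) = digits w.
Proof.
move=> pw; have w0 := primitive_size pw.
have mw : min_even_period (cf_word w) (digits w).
  by split; [exact: even_period_digits | move=> s; exact: even_period_size].
apply: (xget_unique [::] (P := [set s | min_even_period (cf_word w) s]%classic)) => //.
move=> s [ps /(_ _ mw.1) le_s].
have sz : size s = size (digits w).
  by apply/eqP; rewrite eqn_leq le_s even_period_size.
apply: (@eq_from_nth _ 0%N) => // i hi.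
have := even_period_digitsE w0 ps i.
by rewrite /periodic_digits /= subn0 sz modn_small -?sz.
Qed.

Lemma conjunction_cf_word u v : primitive u -> primitive v ->
  conjunction (cf_word u) (cf_word v) = cf_word (u ++ v).
Proof. by move=> pu pv; rewrite /conjunction !period_cf_word // -digits_cat. Qed.

Lemma primitive_rev w : primitive (rev w) = primitive w.
Proof. by rewrite /primitive count_rev size_rev. Qed.

Lemma opposite_cf_word w : primitive w -> opposite (cf_word w) = cf_word (rev w).
Proof. by move=> pw; rewrite /opposite period_cf_word // rev_digits. Qed.

Definition word_sum (t : R) (w : seq bool) := tail_sum t (digits w) (cf_word w).

Lemma Sxt_cf_word t w : primitive w -> Sxt (cf_word w) t = word_sum t w.
Proof.
move=> pw; have w0 := primitive_size pw.
by apply: Sxt_tail_sum; rewrite ?all_digits ?size_digits ?period_cf_word //; lia.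
Qed.

Lemma cf_word_fix w : (0 < size w)%N -> act w (cf_word w) = cf_word w.
Proof.
by move=> w0; apply: purely_periodic_cf_fix; rewrite ?all_digits ?size_digits ?double_gt0.
Qed.

Lemma cf_word_ge1 w : (0 < size w)%N -> 1 <= cf_word w.
Proof.
by move=> w0; apply: purely_periodic_cf_ge1; rewrite ?all_digits ?size_digits ?double_gt0.
Qed.

Lemma cf_word_unique w x : (0 < size w)%N -> 1 <= x -> act w x = x -> x = cf_word w.
Proof.
move=> w0 x1 fx; apply: purely_periodic_cf_unique; rewrite ?all_digits ?size_digits //.
by lia.
Qed.

Lemma cf_word_cat u v : (0 < size (u ++ v))%N ->
  cf_word (u ++ v) = act u (cf_word (v ++ u)).
Proof.
move=> uv0; have vu0 : (0 < size (v ++ u))%N by rewrite size_cat addnC -size_cat.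
symmetry; apply: cf_word_unique => //.
  by apply: cf_act_ge1; rewrite ?all_digits ?cf_word_ge1.
by rewrite -act_cat -catA act_cat cf_word_fix.
Qed.

Lemma word_sum_rot t u v : (0 < size (u ++ v))%N ->
  word_sum t (u ++ v) = word_sum t (v ++ u).
Proof.
move=> uv0; have vu0 : (0 < size (v ++ u))%N by rewrite size_cat addnC -size_cat.
by rewrite /word_sum !digits_cat !tail_sum_cat addrC -!cf_word_cat.
Qed.

(** The fixed point equation improves the bound twice: x >= 1 gives [3/2, 5/2], which every block
    preserves, and one more block raises the lower end to 1 + 3/5 = 8/5. *)
Lemma cf_word_range w : (0 < size w)%N -> in_range (cf_word w).
Proof.
move=> w0.
have act1_ge b (y : R) : 1 <= y -> 3 / 2 <= act [:: b] y <= 5 / 2.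
  move=> y1; have i0 : 0 < y^-1 <= 1 by rewrite invr_gt0 invf_le1 //; lra.
  case/andP: i0 => i0 i1.
  have : 1 / 2 <= (1 + y^-1)^-1 <= 1 by apply: (@inv_range _ 1 2); lra.
  have : 1 / 3 <= (2 + y^-1)^-1 <= 1 / 2 by apply: (@inv_range _ 2 3); lra.
  by case: b; rewrite !act1E => /andP[? ?] /andP[? ?]; apply/andP; split; lra.
have act_ge z (y : R) : 3 / 2 <= y <= 5 / 2 -> 3 / 2 <= act z y <= 5 / 2.
  elim: z => // b z IH /IH/andP[h _]; rewrite -cat1s act_cat.
  by apply: act1_ge; lra.
have x1 := cf_word_ge1 w0; have fx := cf_word_fix w0.
move: (cf_word w) x1 fx => x x1; case: w w0 => // b w _.
rewrite -cat1s act_cat => fx.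
have x2 : 3 / 2 <= x <= 5 / 2.
  by rewrite -fx act1_ge // cf_act_ge1 // all_digits.
have /andP[y1 y2] := act_ge w _ x2.
rewrite -fx /in_range; move: (act w x) y1 y2 => y y1 y2.
have /andP[i1 i2] : 2 / 5 <= y^-1 <= 2 / 3 by apply: (@inv_range _ (3 / 2) (5 / 2)); lra.
have : 3 / 5 <= (1 + y^-1)^-1 <= 1 by apply: (@inv_range _ 1 (5 / 3)); lra.
have : 0 <= (2 + y^-1)^-1 <= 1 / 2 by apply: (@inv_range _ 2 3); lra.
by case: b fx => _; rewrite !act1E => /andP[? ?] /andP[? ?]; apply/andP; split; lra.
Qed.

(** After the common prefix, a block 1, 1 yields at most 7/4 and a block 2, 2 at least 19/8; the
    prefix is strictly increasing. *)
Lemma cf_word_lt z p q : cf_word (z ++ false :: p) < cf_word (z ++ true :: q).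
Proof.
have fixE b s : exists2 y, in_range y &
    cf_word (z ++ b :: s) = act z (act [:: b] y).
  have w0 : (0 < size (z ++ b :: s))%N by rewrite size_cat /= addnS.
  exists (act s (cf_word (z ++ b :: s))); first exact/act_range/cf_word_range.
  by rewrite -!act_cat -?catA; symmetry; apply: cf_word_fix.
have [y hy ->] := fixE false p; have [y' hy' ->] := fixE true q.
apply: act_lt; try exact: act_range.
have [/andP[_ y1] _] := act1_range hy; have [_ /andP[y2 _]] := act1_range hy'.
by apply: le_lt_trans y1 (lt_le_trans _ y2); lra.
Qed.
End Words.

(** * Comparison of conjoined words *)

(** In the free group X is the conjugate of [w] by [U]; the condition is that X is again a word in
    the two letters. *)
Definition slides (U w : seq bool) := exists X, U ++ w = X ++ U.

Lemma slides_cat U v w : slides U v -> slides U w -> slides U (v ++ w).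
Proof.
move=> [X Xv] [Z Zw]; exists (X ++ Z).
by rewrite catA Xv -catA Zw catA.
Qed.

Definition wpow k (w : seq bool) := flatten (nseq k w).

Lemma wpowSr k w : wpow k.+1 w = wpow k w ++ w.
Proof.
elim: k => [|k IH]; first exact: cats0.
by rewrite -[LHS]/(w ++ wpow k.+1 w) [in LHS]IH catA.
Qed.

Lemma wpow_add k l w : wpow (k + l) w = wpow k w ++ wpow l w.
Proof. by rewrite /wpow nseqD flatten_cat. Qed.

Lemma wpow_shift k u v : wpow k (u ++ v) ++ u = u ++ wpow k (v ++ u).
Proof.
elim: k => [|k IH]; first by rewrite /= cats0.
rewrite -[wpow k.+1 (u ++ v)]/((u ++ v) ++ wpow k _) -catA IH.
by rewrite -[wpow k.+1 (v ++ u)]/((v ++ u) ++ wpow k _) !catA.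
Qed.

Lemma rev_wpow k w : rev (wpow k w) = wpow k (rev w).
Proof. by elim: k => // k IH; rewrite {1}wpowSr rev_cat IH. Qed.

Lemma slides_wpow U k w : slides U w -> slides U (wpow k w).
Proof.
move=> sw; elim: k => [|k IH]; first by exists [::]; rewrite cats0.
exact: slides_cat.
Qed.

Section Comparison.
Variable R : realType.
Local Notation cf w := (cf_word R w).

(** Let E, B, C, A be the values of u, uv, vu, v, so that B = u C. If C < E, then nonexpansion of u
    gives E - B <= E - C, contradicting B < C. Hence E <= C, and applying u gives E <= B; the other
    half is symmetric. *)
Lemma cf_word_order u v : (0 < size u)%N -> (0 < size v)%N ->
  cf (u ++ v) < cf (v ++ u) -> cf u <= cf (u ++ v) /\ cf (v ++ u) <= cf v.
Proof.
move=> u0 v0 BC.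
have uv0 : (0 < size (u ++ v))%N by rewrite size_cat; lia.
have vu0 : (0 < size (v ++ u))%N by rewrite size_cat; lia.
have rB := cf_word_range R uv0; have rC := cf_word_range R vu0.
have rE := cf_word_range R u0; have rA := cf_word_range R v0.
have fE := cf_word_fix R u0; have fA := cf_word_fix R v0.
have uC := cf_word_cat R uv0; have vB := cf_word_cat R vu0.
split.
  rewrite -fE uC; apply: act_le => //; rewrite leNgt; apply/negP => h.
  by have := act_slope u rC rE (ltW h); rewrite fE -uC => /andP[]; lra.
rewrite -fA vB; apply: act_le => //; rewrite leNgt; apply/negP => h.
by have := act_slope v rA rB (ltW h); rewrite fA -vB => /andP[]; lra.
Qed.

Variable t : R.
Hypothesis ht : - (1 / 2) <= cos t <= 1 / 2.
Local Notation G w := (tail_sum t (digits w)).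
Local Notation N := (potential t).

Lemma tail_sum_slide U X w (y : R) : U ++ w = X ++ U ->
  G w y = G X (act U y) + G U y - G U (act w y).
Proof.
move=> e; have : G (U ++ w) y = G (X ++ U) y by rewrite e.
by rewrite !digits_cat !tail_sum_cat; lra.
Qed.

Lemma act_slide U X w (y : R) : U ++ w = X ++ U ->
  act U (act w y) = act X (act U y).
Proof. by move=> e; rewrite -!act_cat e. Qed.

Lemma word_sum_lt Y u v : (0 < size u)%N -> (0 < size v)%N ->
  slides (false :: Y) u -> slides (true :: Y) v ->
  cf (u ++ v) < cf (v ++ u) ->
  word_sum t (v ++ u) < word_sum t u + word_sum t v.
Proof.
move=> u0 v0 [X eX] [Z eZ] BC.
have uv0 : (0 < size (u ++ v))%N by rewrite size_cat; lia.
have vu0 : (0 < size (v ++ u))%N by rewrite size_cat; lia.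
have [EB CA] := cf_word_order u0 v0 BC.
have EC := le_trans EB (ltW BC); have BA := le_trans (ltW BC) CA.
have fE := cf_word_fix R u0; have fA := cf_word_fix R v0.
have uC := cf_word_cat R uv0; have vB := cf_word_cat R vu0.
rewrite /word_sum digits_cat tail_sum_cat -uC {EB CA}.
have rE := cf_word_range R u0; have rA := cf_word_range R v0.
have rB := cf_word_range R uv0; have rC := cf_word_range R vu0.
move: (cf u) (cf v) (cf (u ++ v)) (cf (v ++ u)) => E A B C
  in fE fA uC vB rE rA rB rC EC BA BC *.
have act_U b (y : R) : act (b :: Y) y = act [:: b] (act Y y) by rewrite -act_cat.
have G_U b (y : R) : G (b :: Y) y = G [:: b] (act Y y) + G Y y.
  by rewrite -cat1s digits_cat tail_sum_cat.
(* Since u E = E and u C = B, all terms at E cancel, both in [G] and in the potential bound for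
   X. *)
have upper : G u C - G u E <= G (false :: Y) C - G (false :: Y) B +
    (N (act (false :: Y) C) - N (act (false :: Y) B)).
  rewrite (tail_sum_slide C eX) (tail_sum_slide E eX) -uC fE.
  have := act_slide C eX; have := act_slide E eX; rewrite -uC fE => hE hC.
  have rU (y : R) : in_range y -> in_range (act (false :: Y) y) by apply: act_range.
  have := tail_sum_slope ht X (rU _ rE) (rU _ rC) (act_le _ rE rC EC).
  by rewrite -hE -hC => /andP[_]; lra.
(* Since v A = A and v B = C, the terms at A cancel, and the increment of [G Z] is nonnegative. *)
have lower : G (true :: Y) C - G (true :: Y) B <= G v A - G v B.
  rewrite (tail_sum_slide A eZ) (tail_sum_slide B eZ) -vB fA.
  have rU (y : R) : in_range y -> in_range (act (true :: Y) y) by apply: act_range.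
  have := tail_sum_le ht Z (rU _ rB) (rU _ rA) (act_le _ rB rA BA).
  lra.
(* The contributions of Y to both brackets agree, so only the first letters are compared, at the
   points Y B < Y C. *)
have := block_tail_sum_lt ht (act_range Y rB) (act_range Y rC) (act_lt Y rB rC BC).
move: upper lower; rewrite !G_U !act_U.
lra.
Qed.

Lemma word_sum_wpow k w : (0 < size w)%N ->
  word_sum t (wpow k w) = k%:R * word_sum t w.
Proof.
move=> w0; case: k => [|k]; first by rewrite /word_sum mul0r.
have fix_pow j : act (wpow j w) (cf w) = cf w.
  by elim: j => //= j IH; rewrite act_cat IH cf_word_fix.
rewrite /word_sum; have <- : cf w = cf (wpow k.+1 w).
  by apply: cf_word_unique; rewrite ?cf_word_ge1 //= size_cat; lia.
elim: k.+1 => [|j IH]; first by rewrite mul0r.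
by rewrite /= digits_cat tail_sum_cat fix_pow IH -natr1; ring.
Qed.

(** Sliding is stable under concatenation and powers, so four short words suffice to make u(vu)^k
    and v(uv)^k slide. *)
Lemma word_sum_pow_lt k Y u v : (0 < size u)%N -> (0 < size v)%N ->
  slides (false :: Y) u -> slides (false :: Y) (v ++ u) ->
  slides (true :: Y) v -> slides (true :: Y) (u ++ v) ->
  cf (u ++ v) < cf (v ++ u) ->
  (2 * k + 1)%:R * word_sum t (v ++ u) <
    word_sum t (u ++ wpow k (v ++ u)) + word_sum t (v ++ wpow k (u ++ v)).
Proof.
move=> u0 v0 s1 s2 s3 s4 BC.
have pow_eq x y : (x ++ wpow k (y ++ x)) ++ (y ++ wpow k (x ++ y)) =
    wpow (2 * k + 1) (x ++ y).
  rewrite -(wpow_shift k x y) -catA [x ++ (y ++ _)]catA.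
  rewrite -[(x ++ y) ++ _]/(wpow k.+1 (x ++ y)) -wpow_add.
  by congr wpow; lia.
have pos x y : (0 < size x)%N -> (0 < size (x ++ y))%N by rewrite size_cat; lia.
have cf_pow w : (0 < size w)%N -> cf (wpow (2 * k + 1) w) = cf w.
  move=> w0; symmetry; apply: cf_word_unique; rewrite ?cf_word_ge1 //.
    by rewrite addn1 /= size_cat; lia.
  by elim: (2 * k + 1)%N => //= j IH; rewrite act_cat IH cf_word_fix.
rewrite -word_sum_wpow ?pos // -pow_eq.
apply: (word_sum_lt (Y := Y)); rewrite ?pos //.
- by apply: slides_cat => //; apply: slides_wpow.
- by apply: slides_cat => //; apply: slides_wpow.
- by rewrite !pow_eq !cf_pow // pos.
Qed.
End Comparison.

(** * The Farey tree *)

Section Farey.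
Implicit Types p q : rat.

Lemma farey_bounds p q : farey_neighbors p q ->
  [/\ 0 <= numq p, 0 < numq q, 2 * numq p < denq p, 2 * numq q <= denq q
    & denq p * numq q - numq p * denq q = 1].
Proof.
case=> p0 pq q1 e; have := denq_gt0 p; have := denq_gt0 q => dq dp.
have nq : 2 * numq q <= denq q.
  move: q1; rewrite -[q in X in X -> _]divq_num_den ler_pdivrMr ?ltr0z //.
  by rewrite mulrC mulrA mulr1 ler_pdivlMr // mulrC -(ler_int rat) intrM.
have np : 0 <= numq p by rewrite numq_ge0.
by split=> //; nia.
Qed.

Lemma mediant_num_den p q : farey_neighbors p q ->
  numq (mediant p q) = numq p + numq q /\ denq (mediant p q) = denq p + denq q.
Proof.
case/farey_bounds => ? ? ? ? e; have := denq_gt0 p; have := denq_gt0 q => dq dp.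
have co : coprime `|numq p + numq q| `|denq p + denq q|.
  (* The determinant of p and the mediant is again 1, which is a Bezout relation. *)
  apply/coprimezP; exists (denq p, - numq p) => /=; lia.
rewrite /mediant coprimeq_num // coprimeq_den // gtr0_sg; last by lia.
rewrite mul1r gt_eqF; last by lia.
by split=> //; rewrite gtr0_norm //; lia.
Qed.

(* The difference of two solutions of [x s - y r = 1] is a multiple of [(r, s)]. *)
Lemma bezout_unique (r s x y x' y' : int) : x * s - y * r = 1 ->
  x' * s - y' * r = 1 -> 0 < x < r -> 0 < x' < r -> x = x' /\ y = y'.
Proof.
move=> e e' /andP[x0 xr] /andP[x0' xr'].
pose k := x' * y - x * y'.
have ex : x - x' = r * k.
  have : x * (x' * s - y' * r) - x' * (x * s - y * r) = r * k by rewrite /k; ring.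
  by rewrite e e' !mulr1.
have ey : y - y' = s * k.
  have : y * (x' * s - y' * r) - y' * (x * s - y * r) = s * k by rewrite /k; ring.
  by rewrite e e' !mulr1.
have k0 : k = 0 by nia.
by rewrite k0 !mulr0 in ex ey; lia.
Qed.

Lemma rat_ext p q : numq p = numq q -> denq p = denq q -> p = q.
Proof. by move=> n d; rewrite -(divq_num_den p) n d divq_num_den. Qed.

(** The parents of a mediant are its neighbors of smaller denominator; with [farey_right_unique]
    this recovers them. *)
Lemma farey_left_unique p p' q : farey_neighbors p q -> farey_neighbors p' q ->
  denq p < denq q -> denq p' < denq q -> p = p'.
Proof.
move=> /farey_bounds[_ _ _ _ e] /farey_bounds[_ _ _ _ e'] d d'.
have := @bezout_unique (denq q) (numq q) _ _ _ _ e e'.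
rewrite !denq_gt0 d d' => /(_ isT isT)[? ?].
exact: rat_ext.
Qed.

Lemma farey_right_unique p q q' : farey_neighbors p q -> farey_neighbors p q' ->
  denq q < denq p -> denq q' < denq p -> q = q'.
Proof.
move=> /farey_bounds[_ _ _ _ e] /farey_bounds[_ _ _ _ e'] d d'.
have := @bezout_unique (denq p) (- numq p) (denq q) (- numq q) (denq q') (- numq q').
rewrite !denq_gt0 d d' => /(_ ltac:(lia) ltac:(lia) isT isT)[? ?].
by apply: rat_ext; lia.
Qed.

Lemma mediant_neighbors p q : farey_neighbors p q ->
  farey_neighbors p (mediant p q) /\ farey_neighbors (mediant p q) q.
Proof.
move=> h; have [n d] := mediant_num_den h; have := farey_bounds h.
case: h => p0 pq q1 e [? ? ? ? _].
have := denq_gt0 p; have := denq_gt0 q => dq dp.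
have cmp (x y : rat) : numq x * denq y < numq y * denq x -> x < y.
  move=> xy; rewrite -(divq_num_den x) -(divq_num_den y).
  rewrite ltr_pdivrMr ?ltr0z ?denq_gt0 // mulrAC.
  by rewrite ltr_pdivlMr ?ltr0z ?denq_gt0 // -!intrM ltr_int.
have pm : p < mediant p q by apply: cmp; rewrite n d; lia.
have mq : mediant p q < q by apply: cmp; rewrite n d; lia.
split; split=> //; rewrite ?n ?d; try lia.
- exact: le_trans (ltW mq) q1.
- exact: le_trans p0 (ltW pm).
Qed.

(** These are the Christoffel words in the letters [true] and [false], with [true] as the first
    letter of the alphabet. *)
Inductive markov_word : rat -> seq bool -> Prop :=
| markov_word_0 : markov_word 0 [:: false]
| markov_word_half : markov_word (1 / 2) [:: true]
| markov_word_mediant p q u v : farey_neighbors p q ->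
    markov_word p u -> markov_word q v -> markov_word (mediant p q) (v ++ u).

Lemma markov_word_inv q w : markov_word q w ->
  [\/ q = 0 /\ w = [:: false], q = 1 / 2 /\ w = [:: true] |
    exists p' q' u v, [/\ farey_neighbors p' q', markov_word p' u,
      markov_word q' v & q = mediant p' q' /\ w = v ++ u]].
Proof.
case=> [||p' q' u v h hu hv]; [exact: Or31|exact: Or32|apply: Or33].
by exists p', q', u, v.
Qed.

Lemma numq_half : numq (1 / 2) = 1 /\ denq (1 / 2) = 2.
Proof. by []. Qed.

Lemma mediant_not_leaf p q : farey_neighbors p q ->
  mediant p q <> 0 /\ mediant p q <> 1 / 2.
Proof.
move=> h; have [n d] := mediant_num_den h; have [? ? ? ? ?] := farey_bounds h.
have [n2 d2] := numq_half.
have n0 : numq 0 = 0 by [].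
have dp := denq_gt0 p; have dq := denq_gt0 q.
by split=> e; move: n d; rewrite e ?n2 ?d2 ?n0; lia.
Qed.

Lemma markov_word_unique q w w' : markov_word q w -> markov_word q w' -> w = w'.
Proof.
move=> h; elim: h w' => {q w} [||p q u v h hu IHu hv IHv] w'.
- case/markov_word_inv => [[_ ->]//|[]//|[p' [q' [u' [v' [h _ _ [e _]]]]]]].
  by case: (mediant_not_leaf h) => [[]].
- case/markov_word_inv => [[]//|[_ ->]//|[p' [q' [u' [v' [h _ _ [e _]]]]]]].
  by case: (mediant_not_leaf h) => [_ []].
have [m1 m2] := mediant_not_leaf h.
case/markov_word_inv => [[]//|[]//|[p' [q' [u' [v' [h' hu' hv' [e ->]]]]]]].
have [a b] := mediant_neighbors h; have [a' b'] := mediant_neighbors h'.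
have [_ d] := mediant_num_den h; have [_ d'] := mediant_num_den h'.
rewrite -e in a' b' d'.
have := denq_gt0 p; have := denq_gt0 q; have := denq_gt0 p'; have := denq_gt0 q'.
move=> ? ? ? ?.
have pp : p = p' by apply: farey_left_unique a a' _ _; lia.
have qq : q = q' by apply: farey_right_unique b b' _ _; lia.
by rewrite (IHu u') ?pp // (IHv v') ?qq.
Qed.

Lemma markov_word_counts q w : markov_word q w ->
  (count_mem true w)%:Z = numq q /\ (size w)%:Z = denq q - numq q.
Proof.
elim=> {q w} [//|//|p q u v h _ [cu su] _ [cv sv]].
have [n d] := mediant_num_den h.
by rewrite count_cat size_cat !PoszD cu cv su sv n d; split; lia.
Qed.

Lemma markov_word_primitive q w : markov_word q w -> primitive w.
Proof.
move=> /markov_word_counts[c s]; have := coprime_num_den q.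
have -> : `|numq q|%N = count_mem true w by lia.
have -> : `|denq q|%N = (size w + count_mem true w)%N by have := denq_gt0 q; lia.
by rewrite /primitive /coprime gcdnDr.
Qed.

(** The neighbor determinant read off from letter counts. It survives both kinds of conjunction,
    which gives primitivity along the iterated conjunctions without following Farey parameters. *)
Definition unimodular (u v : seq bool) :=
  (count_mem true v * size u = (count_mem true u * size v).+1)%N.

Lemma unimodular_primitive u v : unimodular u v -> primitive u /\ primitive v.
Proof.
rewrite /unimodular /primitive /coprime => e.
have co g a b : (g %| a)%N -> (g %| b)%N -> a = b.+1 -> g == 1%N.
  by move=> ga gb ab; move: ga; rewrite ab -addn1 dvdn_addr // dvdn1.
split; apply: (co _ _ _ _ _ e).
- exact: dvdn_mull _ (dvdn_gcdr _ _).
- exact: dvdn_mulr _ (dvdn_gcdl _ _).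
- exact: dvdn_mulr _ (dvdn_gcdl _ _).
- exact: dvdn_mull _ (dvdn_gcdr _ _).
Qed.

Lemma unimodular_catl u v : unimodular u v -> unimodular (v ++ u) v.
Proof. by rewrite /unimodular size_cat count_cat; lia. Qed.

Lemma unimodular_catr u v : unimodular u v -> unimodular u (v ++ u).
Proof. by rewrite /unimodular size_cat count_cat; lia. Qed.

Lemma markov_word_unimodular p q u v : farey_neighbors p q ->
  markov_word p u -> markov_word q v -> unimodular u v.
Proof.
move=> /farey_bounds[_ _ _ _ e] /markov_word_counts[cu su] /markov_word_counts[cv sv].
apply/eqP; rewrite -eqz_nat -addn1 PoszD !PoszM cu cv su sv; lia.
Qed.

(** The last identity says that v u and u v differ only by the transposition of two adjacent
    letters, right after Z. In the induction, the neighbor of larger denominator is a mediant with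
    the other one as a parent; its word extends Y or Z, and the old identity is multiplied by u on
    the right or by v on the left. *)
Lemma markov_word_neighbors p q u v : farey_neighbors p q ->
  markov_word p u -> markov_word q v -> exists Z Y,
  [/\ u = Z ++ [:: false], v = true :: Y
    & true :: Y ++ Z ++ [:: false] = Z ++ [:: true, false & Y]].
Proof.
have [n] := ubnP `|(denq p + denq q)%R|%N.
elim: n p q u v => // n IH p q u v lt_n h hu hv.
have [p0 q0 p1 q1 e] := farey_bounds h.
have dp := denq_gt0 p; have dq := denq_gt0 q.
have [lt_d|lt_d|eq_d] := ltgtP (denq p) (denq q).
- case/markov_word_inv: hv => [[q0' _]|[qh ->]|[p' [q' [u' [v' [h' hu' hv' [em ->]]]]]]].
  + by rewrite q0' in q0.
  + have [n2 d2] := numq_half; rewrite qh in e q0 q1 lt_d; rewrite n2 d2 in e lt_d.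
    case/markov_word_inv: hu => [[_ ->]|[ph _]|[p' [q' [u' [v' [h' _ _ [em _]]]]]]].
    * by exists [::], [::].
    * by rewrite ph in lt_d.
    * have [_ ? ? ? _] := farey_bounds h'; have [_ d] := mediant_num_den h'.
      by rewrite -em in d; have := denq_gt0 p'; have := denq_gt0 q'; lia.
  have [a b] := mediant_neighbors h'; have [_ d] := mediant_num_den h'.
  rewrite -em in a b d.
  have dp' := denq_gt0 p'; have dq' := denq_gt0 q'.
  have pp : p = p' by apply: farey_left_unique h a _ _; lia.
  rewrite pp in hu *; rewrite (markov_word_unique hu' hu).
  have [|Z [Y [-> -> eZY]]] := IH p' q' u v' _ h' hu hv'.
    by rewrite pp in lt_n dp; lia.
  exists Z, (Y ++ Z ++ [:: false]); split=> //.
  by rewrite -[LHS]/((true :: Y ++ Z ++ [:: false]) ++ _) eZY -catA.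
- case/markov_word_inv: hu => [[p0' _]|[ph _]|[p' [q' [u' [v' [h' hu' hv' [em ->]]]]]]].
  + by rewrite p0' (erefl : denq 0 = 1) in lt_d; lia.
  + have [n2 d2] := numq_half; rewrite ph n2 d2 in p1; lia.
  have [a b] := mediant_neighbors h'; have [_ d] := mediant_num_den h'.
  rewrite -em in a b d.
  have dp' := denq_gt0 p'; have dq' := denq_gt0 q'.
  have qq : q = q' by apply: farey_right_unique h b _ _; lia.
  rewrite qq in hv *; rewrite (markov_word_unique hv' hv).
  have [|Z [Y [-> -> eZY]]] := IH p' q' u' v _ h' hu' hv.
    by rewrite qq in lt_n dq; lia.
  exists (true :: Y ++ Z), Y; split=> //; first by rewrite /= catA.
  by rewrite /= -!catA eZY.
(* Equal denominators would have to be 1, impossible for 0 < q <= 1/2. *)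
- have : denq q * (numq q - numq p) = 1 by rewrite -e eq_d; ring.
  have : numq q - numq p <= 0 \/ 1 <= numq q - numq p by lia.
  by move: (numq q - numq p) => j; nia.
Qed.
End Farey.

(** * From Markov irrationalities to words, and the two inequalities *)

Section Main.
Variable R : realType.
Local Notation cf w := (cf_word R w).

Lemma markov_cf_word (q : rat) (x : R) : Defs.markov q x ->
  exists2 w, markov_word q w & x = cf w.
Proof.
elim=> {q x} [||p q x y h _ [u hu ->] _ [v hv ->]].
- by exists [:: false]; first exact: markov_word_0.
- by exists [:: true]; first exact: markov_word_half.
exists (v ++ u); first exact: markov_word_mediant.
by rewrite conjunction_cf_word //; apply: markov_word_primitive; eassumption.
Qed.

Lemma conj_pow_l_cf_word k u v : unimodular u v ->
  conj_pow_l k (cf v) (cf u) = cf (wpow k v ++ u) /\ unimodular (wpow k v ++ u) v.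
Proof.
move=> uv; elim: k => [//|k [e h]].
have [pw pv] := unimodular_primitive h.
split; last by rewrite -catA; exact: unimodular_catl.
by rewrite /conj_pow_l iterS -/(conj_pow_l k _ _) e conjunction_cf_word // catA.
Qed.

Lemma conj_pow_r_cf_word k u v : unimodular u v ->
  conj_pow_r k (cf v) (cf u) = cf (v ++ wpow k u) /\ unimodular u (v ++ wpow k u).
Proof.
move=> uv; elim: k => [|k [e h]]; first by rewrite cats0.
have [pu pw] := unimodular_primitive h.
rewrite wpowSr catA; split; last exact: unimodular_catr.
by rewrite /conj_pow_r iterS -/(conj_pow_r k _ _) e conjunction_cf_word.
Qed.

Lemma markov_neighbors_words (x y : R) : markov_neighbors x y -> x < y ->
  exists u v, [/\ x = cf u, y = cf v, unimodular u v &
    exists Z Y, [/\ u = Z ++ [:: false], v = true :: Y &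
    true :: Y ++ Z ++ [:: false] = Z ++ [:: true, false & Y]]].
Proof.
case=> p [q [/markov_cf_word[u hu ->] /markov_cf_word[v hv ->] h xy]].
case: h => h.
  exists u, v; split=> //; first exact: markov_word_unimodular h hu hv.
  exact: markov_word_neighbors h hu hv.
(* With the parameters in the opposite order, v u and u v first differ after Z, and [cf_word_order]
   then forces y < x. *)
have [Z [Y [eu ev e]]] := markov_word_neighbors h hv hu.
have e' : v ++ u = Z ++ [:: false, true & Y] by rewrite eu ev -catA.
have e2 : u ++ v = Z ++ [:: true, false & Y] by rewrite eu ev -e.
have u0 : (0 < size u)%N by rewrite ev.
have v0 : (0 < size v)%N by rewrite eu size_cat addnC.
have lt := cf_word_lt R Z (true :: Y) (false :: Y).
rewrite -e' -e2 in lt.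
have [] := cf_word_order v0 u0 lt.
have uv0 : (0 < size (u ++ v))%N by rewrite size_cat; lia.
by move: xy lt; lra.
Qed.

(** Strip the common first letter [b] from the identity and put [~~ b] in its place: the right side
    then ends in [~~ b :: Y]. *)
Lemma slides_transposition b Y Z :
  b :: Y ++ Z ++ [:: ~~ b] = Z ++ [:: b, ~~ b & Y] ->
  slides (~~ b :: Y) (Z ++ [:: ~~ b]).
Proof.
case: Z => [|z Z] /= [].
  by move=> e; exists [:: ~~ b]; rewrite /= e.
by move=> <- e; exists (~~ b :: Z ++ [:: b]); rewrite /= e -catA.
Qed.

End Main.

Theorem theorem6p5 (R : realType) (W1 w2 W3 : R) (k : nat) (w1 w3 : R)
  (hW1 : markov_irrationality W1) (hw2 : markov_irrationality w2)
  (hW3 : markov_irrationality W3)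
  (hlt12 : W1 < w2) (hlt23 : w2 < W3)
  (hnb : markov_neighbors W1 W3)
  (hw2E : w2 = conjunction W3 W1)
  (hw1E : w1 = conj_pow_l k w2 W1)
  (hw3E : w3 = conj_pow_r k W3 w2)
  (t : R) (ht1 : pi / 3 <= t) (ht2 : t <= 2 * pi / 3) :
  (2 * k + 1)%:R * Sxt w2 t < Sxt w1 t + Sxt w3 t /\
  (2 * k + 1)%:R * Sxt (opposite w2) t
    < Sxt (opposite w1) t + Sxt (opposite w3) t.
Proof.
have ht := cos_middle_third ht1 ht2.
have [u [v [eW1 eW3 uv [Z [Y [eu ev eZY]]]]]] :=
  markov_neighbors_words hnb (lt_trans hlt12 hlt23).
have [pu pv] := unimodular_primitive uv.
have u_vu : unimodular u (v ++ u) := unimodular_catr uv.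
have vu_v : unimodular (v ++ u) v := unimodular_catl uv.
have [_ pw] := unimodular_primitive u_vu.
have e2 : w2 = cf_word R (v ++ u) by rewrite hw2E eW1 eW3 conjunction_cf_word.
have [e1 h1] := conj_pow_l_cf_word R k u_vu.
have [e3 h3] := conj_pow_r_cf_word R k vu_v.
rewrite -e2 -eW1 -hw1E in e1; rewrite -e2 -eW3 -hw3E in e3.
have [p1 _] := unimodular_primitive h1; have [_ p3] := unimodular_primitive h3.
have p0 := primitive_size.
rewrite e1 e2 e3 !opposite_cf_word // !Sxt_cf_word ?primitive_rev //.
have evu : v ++ u = Z ++ [:: true, false & Y] by rewrite ev eu -eZY.
have euv : u ++ v = Z ++ [:: false, true & Y] by rewrite ev eu -catA.
split.
  have -> : word_sum t (wpow k (v ++ u) ++ u) = word_sum t (u ++ wpow k (v ++ u)).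
    exact/word_sum_rot/p0.
  have -> : word_sum t (v ++ wpow k (v ++ u)) = word_sum t (v ++ wpow k (u ++ v)).
    by rewrite word_sum_rot ?p0 // wpow_shift.
  (* Any word ending in U slides through U. This settles vu, v and uv, which end in 0 Y, 1 Y and 1
     Y; only u calls for the transposition identity. *)
  apply: (word_sum_pow_lt ht k (Y := Y)); rewrite ?p0 //.
  - by rewrite eu; exact: (@slides_transposition true).
  - by rewrite evu; exists (false :: Y ++ Z ++ [:: true]); rewrite /= -!catA.
  - by rewrite ev; exists (true :: Y).
  - rewrite euv; exists (true :: Y ++ Z ++ [:: false]); by rewrite /= -!catA.
  - by rewrite evu euv; exact: cf_word_lt.
(* The reversed identity has the same shape with the letters exchanged, and the reversal of Z takes
   the place of Y. Now u' is itself 0 Z', and v' is the word that calls for the transposition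
   identity. *)
have eYZ : false :: rev Z ++ rev Y ++ [:: true] = rev Y ++ [:: false, true & rev Z].
  have := congr1 rev eZY.
  by rewrite rev_cons -cats1 !rev_cat !rev_cons -!cats1 -!catA.
rewrite !(rev_cat, rev_wpow).
have -> : rev u = false :: rev Z by rewrite eu rev_cat.
have -> : rev v = rev Y ++ [:: true] by rewrite ev rev_cons -cats1.
move: (rev Y) (rev Z) eYZ => Y' Z' eYZ.
set u' := false :: Z'; set v' := Y' ++ [:: true].
have u0 : (0 < size u')%N by [].
have v0 : (0 < size v')%N by rewrite size_cat addnC.
have euv' : u' ++ v' = Y' ++ [:: false, true & Z'] by [].
have evu' : v' ++ u' = Y' ++ [:: true, false & Z'] by rewrite -catA.
have cat0 x y : (0 < size x)%N || (0 < size y)%N -> (0 < size (x ++ y))%N.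
  by rewrite size_cat; lia.
have -> : word_sum t (u' ++ v') = word_sum t (v' ++ u') by rewrite word_sum_rot.
have -> : word_sum t (u' ++ wpow k (u' ++ v')) = word_sum t (u' ++ wpow k (v' ++ u')).
  by rewrite word_sum_rot ?wpow_shift.
have -> : word_sum t (wpow k (u' ++ v') ++ v') = word_sum t (v' ++ wpow k (u' ++ v')).
  by rewrite word_sum_rot // cat0 // v0 orbT.
apply: (word_sum_pow_lt ht k (Y := Z')) => //.
- by exists u'.
- by rewrite evu'; exists (false :: Z' ++ Y' ++ [:: true]); rewrite /= -!catA.
- exact: (@slides_transposition false).
- by rewrite euv'; exists (true :: Z' ++ Y' ++ [:: false]); rewrite /= -!catA.
- by rewrite evu' euv'; exact: cf_word_lt.
Qed.
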